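(* For the tokenized multi-armed bandit (TMAB) problem (without the DDMC assumption) with token set of size $n$, maximal depth $L$ and horizon $T$, every algorithm has worst-case expected regret $$\Omega\Big(\min\big(\sqrt{n^{L}T},\,T\big)\Big),$$ i.e., for every algorithm there is a TMAB instance, with monotone utility having small single-level deviation, on which its expected regret is $\Omega(\min(\sqrt{n^LT},T))$.
   Context: **Sequences.** $\mathcal V$ is a finite token set, $|\mathcal V|=n$, containing a special token $\mathrm{EOS}$. For a finite token sequence $\mathbf y$, $|\mathbf y|$ is its length and $\mathbf y^{(1:j)}$ its prefix of length $j$. A sequence is complete if its last token is $\mathrm{EOS}$. Algorithms output only complete sequences of length at most $L$ ($L$ is known). **TMAB problem.** There is an unknown utility function $u$ from finite token sequences to $\mathbb R_{\ge0}$, the same in all rounds (the query is fixed and suppressed). In each round $t\in[T]$ the decision maker irrevocably chooses tokens one by one to build a complete sequence $\mathbf y_t$ with $|\mathbf y_t|\le L$ and then observes only the random reward $r_t(\mathbf y_t)=u(\mathbf y_t)+\eta_t$, where $\eta_t$ is zero-mean noise with $|\eta_t|\le\sigma$. The regret is $\mathrm{Reg}=T\max_{\mathbf z}u(\mathbf z)-\sum_{t=1}^T\mathbb E[u(\mathbf y_t)]$, the maximum over complete sequences of length at most $L$. **Monotone.** (i) Appending further $\mathrm{EOS}$ tokens to a sequence ending in $\mathrm{EOS}$ does not change the utility; (ii) appending a non-$\mathrm{EOS}$ token to a sequence ending in $\mathrm{EOS}$ can only decrease the utility. **Small single-level deviation (SSLD).** Let $\mathbf o$ be the optimal complete sequence.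 For any sequence $\mathbf a$ that deviates from $\mathbf o$ for the first time at level $i$, $|u(\mathbf o^{(1:i)})-u(\mathbf a^{(1:i)})|\le\varepsilon$, with $\varepsilon=O(1/\sqrt T)$.
   Formalization: The formal theorem assumes n ≥ 2 and L ≥ 2: for n = 1 or L = 1 all admissible sequences have equal utility and the regret is 0. It adds a version for utilities at most 1, where the constant depends on n. *)

(* Defs.v *)
From HB Require Import structures.
From mathcomp Require Import all_boot all_order all_algebra.
From mathcomp Require Import all_classical all_reals all_analysis.
Set Implicit Arguments.
Unset Strict Implicit.
Unset Printing Implicit Defensive.
Import Order.TTheory GRing.Theory Num.Theory.
Import numFieldNormedType.Exports.
Local Open Scope ring_scope.

Section Sequences.
Variables (V : finType) (eos : V).

Definition is_complete (y : seq V) : bool := (y != [::]) && (last eos y == eos).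

(* The prefixes that can still be turned into a complete sequence of length at
   most L. EOS need not end a sequence: only a stop decision does. *)
Definition feasible (L : nat) (p : seq V) : bool :=
  (size p < L)%N || ((size p == L) && is_complete p).

End Sequences.

Section Utility.
Variables (R : realType) (V : finType) (eos : V).
Implicit Types u : seq V -> R.

Definition monotone_utility u : Prop :=
  (forall y, is_complete eos y -> u (rcons y eos) = u y) /\
  (forall y v, is_complete eos y -> v != eos -> u (rcons y v) <= u y).

Definition is_optimal (L : nat) u (o : seq V) : Prop :=
  [/\ is_complete eos o, (size o <= L)%N &
      forall z, is_complete eos z -> (size z <= L)%N -> u z <= u o].

(* The optimum need not be unique (EOS padding does not change the utility), so
   the condition is imposed at every optimal sequence. The 0-based position i
   is level i.+1. *)
Definition ssld (L : nat) (eps : R) u : Prop :=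
  forall o a i, is_optimal L u o ->
    (i < size o)%N -> (i < size a)%N ->
    take i a = take i o -> nth eos a i != nth eos o i ->
    `|u (take i.+1 o) - u (take i.+1 a)| <= eps.

(* The maximal utility; the default 0 is harmless since utilities are
   nonnegative. *)
Definition opt_value (L : nat) u : R :=
  \big[Num.max/0]_(z : L.-bseq V | is_complete eos z) u z.

End Utility.

(* The law of the noise may depend on the chosen sequence. *)
Record tmab (R : realType) (V : finType) (sigma : R) := TMAB {
  utility : seq V -> R;
  noise : seq V -> probability (measurableTypeR R) R;
  utility_ge0 : forall y, 0 <= utility y;
  noise_bounded : forall y, noise y `[- sigma, sigma]%classic = 1%:E;
  noise_mean0 : forall y, \int[noise y]_x x = 0 }.

(* A history lists the past (sequence, reward) pairs, oldest first. *)
Definition history (R : realType) (V : finType) := seq (seq V * R).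

(* A randomized algorithm: next h p is the law, after the history h and once
   the tokens p of the current round have been chosen, of the next decision:
   append v (Some v) or submit p (None). *)
Record algorithm (R : realType) (V : finType) (eos : V) (L : nat) := Algorithm {
  next : history R V -> seq V -> option V -> R;
  next_ge0 : forall h p d, 0 <= next h p d;
  next_sum1 : forall h p, feasible eos L p -> \sum_(d : option V) next h p d = 1;
  next_stop : forall h p, 0 < next h p None -> is_complete eos p;
  next_token : forall h p v, 0 < next h p (Some v) -> feasible eos L (rcons p v);
  next_measurable : forall (ys : seq (seq V)) p d,
    measurable_fun [set: (size ys).-tuple (measurableTypeR R)]
      (fun r : (size ys).-tuple (measurableTypeR R) =>
         next (zip ys r) p d : measurableTypeR R) }.

Section Regret.
Variables (R : realType) (V : finType) (eos : V) (sigma : R) (L : nat).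
Variables (A : algorithm R eos L) (I : tmab V sigma).

(* The probability that, after the history h, the algorithm builds and submits
   the sequence y. *)
Definition output_prob (h : history R V) (y : seq V) : R :=
  (\prod_(j < size y) next A h (take j y) (Some (nth eos y j)))
  * next A h y None.

(* The expected utility of the sequence submitted k rounds after the history h
   (k = 0 is the round immediately following h). *)
Fixpoint expected_utility (k : nat) (h : history R V) : R :=
  \sum_(y : L.-bseq V | is_complete eos y) output_prob h y *
    if k is k'.+1 then
      \int[noise I y]_e
        expected_utility k' (rcons h (val y, utility I y + e))
    else utility I y.

Definition regret (T : nat) : R :=
  T%:R * opt_value eos L (utility I) - \sum_(t < T) expected_utility t [::].

End Regret.

Definition rate (R : realType) (n L T : nat) : R :=
  Num.min (Num.sqrt ((n ^ L * T)%:R)) T%:R.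

(* Main.v *)
Require Import Defs.
From HB Require Import structures.
From mathcomp Require Import all_boot all_order all_algebra.
From mathcomp Require Import all_classical all_reals all_analysis.
From mathcomp Require Import measurable_realfun ring lra.
Set Implicit Arguments.
Unset Strict Implicit.
Unset Printing Implicit Defensive.
Import Order.TTheory GRing.Theory Num.Theory.
Import numFieldNormedType.Exports.
Local Open Scope ring_scope.

(** Ignoring the last token and all trailing EOS tokens sorts the sequences of
    length at most L into n ^ (L - 1) classes ("arms"). A utility that is
    constant on one arm and zero elsewhere is monotone, and its single-level
    deviation is exactly 0, because sequences that agree on i tokens have
    prefixes of length i + 1 in the same arm.

    If utilities may be large, an algorithm hits a random arm in the first round
    with probability at most 1/2, and an arm of height 2T does the job.

    If utilities are at most 1, let the rewards be s or -s, with a fair coin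
    outside the distinguished arm w and with bias 1/2 + d on w. Under the null
    law (no distinguished arm), the likelihood ratio of instance w is at least
    1 + 2 d X - 8 d^2 N, where N counts the plays of w and X, the sum of the
    reward signs over these plays, is a martingale with E X^2 = E N. Hence the
    probability of missing w under instance w is at least 7/8 - P0(hit w) -
    16 d^2 E0 N. Over all w, the terms P0(hit w) sum to 1 and the terms E0 N to
    at most T, so for d^2 of order n ^ (L - 1) / T some instance has a constant
    fraction of misses, each costing 2 s d. *)

(** * Two-point laws for the noise *)

Section TwoPointLaw.
Import HBNNSimple.
Variables (R : realType) (p : R) (z : bool -> R).

Definition two_point_rv (b : bool) : measurableTypeR R := z b.

Lemma measurable_two_point_rv : measurable_fun [set: bool] two_point_rv.
Proof. by []. Qed.

HB.instance Definition _ :=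
  @isMeasurableFun.Build _ _ _ _ two_point_rv measurable_two_point_rv.

Definition two_point : probability (measurableTypeR R) R :=
  distribution (bernoulli_prob p) two_point_rv.

Hypothesis p01 : 0 <= p <= 1.

Lemma two_point_itv a b : (forall c, a <= z c <= b) ->
  two_point `[a, b]%classic = 1%:E.
Proof.
move=> zab; rewrite /two_point /= /distribution /pushforward.
rewrite [X in bernoulli_prob _ X](_ : _ = setT) ?probability_setT//.
by apply/seteqP; split=> // c _ /=; rewrite in_itv /=.
Qed.

(* No measurability is needed for an upper bound, since the integral is a
   supremum over simple functions. *)
Lemma Rintegral_two_point_le (f : R -> R) : (forall x, 0 <= f x) ->
  \int[two_point]_x f x <= p * f (z true) + (1 - p) * f (z false).
Proof.
move=> f0; have /andP[p0 p1] := p01.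
have q0 : 0 <= 1 - p by rewrite subr_ge0.
have lef : (\int[two_point]_x (f x)%:E <=
    (p * f (z true) + (1 - p) * f (z false))%:E)%E.
  rewrite ge0_integralTE; last by move=> x; rewrite lee_fin.
  apply: ge_ereal_sup => _ [h /= hf <-].
  have h0 x : (0 <= (h x)%:E)%E by rewrite lee_fin.
  rewrite -integralT_nnsfun ge0_integral_distribution//; last first.
    exact/measurable_EFinP.
  rewrite (integral_bernoulli_prob p01) => [|b]; last exact: h0.
  by rewrite /= -!EFinM -EFinD lee_fin lerD// ler_wpM2l// -lee_fin hf.
rewrite /Rintegral -lee_fin fineK//.
rewrite fin_num_abs gee0_abs; first exact: le_lt_trans lef (ltry _).
by apply: integral_ge0 => x _; rewrite lee_fin.
Qed.

Lemma Rintegral_two_point_mean :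
  \int[two_point]_x x = p * z true + (1 - p) * z false.
Proof.
(* The Bernoulli integral formula is for nonnegative values, so [z] is shifted by [c] and the shift
   is subtracted again. *)
pose c : R := `|z true| + `|z false|.
have zc b : 0 <= z b + c.
  case: b; rewrite /c.
  - by have := ler_norm (- z true); have := normr_ge0 (z false); rewrite normrN; lra.
  - by have := ler_norm (- z false); have := normr_ge0 (z true); rewrite normrN; lra.
have pT : bernoulli_prob p [set: bool] = 1%E by exact: probability_setT.
have intz (b : R) : (bernoulli_prob p).-integrable setT
    (EFin \o (fun x => z x + b)).
  apply: measurable_bounded_integrable => //=.
    by rewrite pT ltry.
  exists (`|z true + b| + `|z false + b|); split; first exact: num_real.
  move=> M Mlt [] _ /=; apply: le_trans (ltW Mlt).
    by rewrite lerDl.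
  by rewrite lerDr.
rewrite /Rintegral integral_distribution//=.
- have -> : (\int[bernoulli_prob p]_x (z x)%:E)%E =
      (\int[bernoulli_prob p]_x ((z x + c)%:E - c%:E))%E.
    by apply: eq_integral => x _; rewrite -EFinB addrK.
  rewrite integralB//; last 2 first.
  - exact: intz.
  - exact: finite_measure_integrable_cst.
  rewrite integral_bernoulli_prob; [|exact: p01|by move=> b; rewrite lee_fin].
  rewrite integral_cst//= pT mule1 /=.
  by rewrite /unstable.onem; ring.
- have := intz 0.
  by congr (_.-integrable _ _); apply/funext => x /=; rewrite addr0.
Qed.

End TwoPointLaw.

(** * Total mass of the law of the submitted sequence *)

Lemma rcons_tuple_bij (V : finType) m :
  bijective (fun x : m.-tuple V * V => [tuple of rcons x.1 x.2]).
Proof.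
apply: inj_card_bij; last by rewrite card_prod !card_tuple expnSr.
move=> [p v] [q w] /(congr1 val) /= /rcons_inj [pq ->].
by congr (_, _); exact: val_inj.
Qed.

Lemma big_bseq (R : nmodType) (V : finType) n (F : seq V -> R) :
  \sum_(y : n.-bseq V) F y = \sum_(m < n.+1) \sum_(y : m.-tuple V) F y.
Proof.
rewrite sig_big_dep (reindex_onto _ _ (fun y _ => bseq_tagged_tupleK y)) /=.
by apply: eq_bigl => t; rewrite tagged_tuple_bseqK eqxx.
Qed.

Section OutputLaw.
Variables (R : realType) (V : finType) (eos : V) (L : nat).
Variables (A : algorithm R eos L) (h : history R V).
Hypothesis L_gt0 : (0 < L)%N.

Definition reach_prob (p : seq V) : R :=
  \prod_(j < size p) Defs.next A h (take j p) (Some (nth eos p j)).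

Lemma reach_prob_ge0 p : 0 <= reach_prob p.
Proof. by apply: prodr_ge0 => i _; exact: next_ge0. Qed.

Lemma output_prob_ge0 y : 0 <= output_prob A h y.
Proof. by rewrite mulr_ge0 ?next_ge0// reach_prob_ge0. Qed.

Lemma reach_prob_rcons p v :
  reach_prob (rcons p v) = reach_prob p * Defs.next A h p (Some v).
Proof.
rewrite /reach_prob size_rcons big_ord_recr /= nth_rcons ltnn eqxx.
rewrite -cats1 take_size_cat//; congr (_ * _).
by apply: eq_bigr => i _; rewrite take_cat nth_cat ltn_ord.
Qed.

Lemma reach_prob_feasible p : reach_prob p != 0 -> feasible eos L p.
Proof.
elim/last_ind: p => [|p v _]; first by rewrite /feasible L_gt0.
rewrite reach_prob_rcons mulf_eq0 negb_or => /andP[_ nz].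
by apply: (@next_token _ _ _ _ A h); rewrite lt_def nz next_ge0.
Qed.

(** Conservation of mass: a feasible prefix is either extended or submitted, and an infeasible one
    has weight 0. *)
Lemma sum_reach_prob m :
  \sum_(p : m.+1.-tuple V) reach_prob p +
  \sum_(p : m.-tuple V) output_prob A h p = \sum_(p : m.-tuple V) reach_prob p.
Proof.
rewrite (reindex _ (onW_bij _ (rcons_tuple_bij V m))) /=.
rewrite -(pair_big predT predT (fun p v => reach_prob (rcons (tval p) v))) /=.
rewrite -big_split; apply: eq_bigr => p _ /=.
under eq_bigr do rewrite reach_prob_rcons.
rewrite -mulr_sumr /output_prob -/(reach_prob p) -mulrDr.
have [->|/reach_prob_feasible fp] := eqVneq (reach_prob p) 0.
  by rewrite mul0r.
have := next_sum1 A h fp.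
rewrite (bigD1 None)//= (reindex_omap Some id) => [|[]//].
under eq_bigl do rewrite eqxx.
by rewrite addrC => ->; rewrite mulr1.
Qed.

Lemma sum_output_prob :
  \sum_(y : L.-bseq V | is_complete eos y) output_prob A h y = 1.
Proof.
have sumE k : \sum_(m < k) \sum_(y : m.-tuple V) output_prob A h y =
    1 - \sum_(p : k.-tuple V) reach_prob p.
  elim: k => [|k IHk].
    rewrite big_ord0 (big_pred1 [tuple]) ?/reach_prob ?big_ord0 ?subrr//.
    by move=> t; rewrite [t]tuple0 /= eqxx.
  by rewrite big_ord_recr /= IHk -(sum_reach_prob k); lra.
transitivity (\sum_(y : L.-bseq V) output_prob A h y).
  rewrite big_mkcond; apply: eq_bigr => y _; case: ifPn => // ncy.
  rewrite /output_prob; have [->|nz] := eqVneq (Defs.next A h y None) 0.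
    by rewrite mulr0.
  by rewrite (@next_stop _ _ _ _ A h y) ?lt_def ?nz ?next_ge0 in ncy.
(* What remains is the mass of the prefixes of length [L.+1], none of which is feasible. *)
rewrite big_bseq sumE big1 ?subr0// => p _; apply/eqP/negP => /negP.
move=> /reach_prob_feasible; rewrite /feasible size_tuple.
by rewrite ltnNge leqnSn /= gtn_eqF.
Qed.

End OutputLaw.

(** * Arms and needle utilities *)

Section Needle.
Variables (R : realType) (V : finType) (eos : V) (m : nat).

Definition pad (y : seq V) : m.-tuple V := [tuple nth eos y i | i < m].

(* Trailing EOS tokens are ignored up to length m, so the complete sequences of
   length at most m.+1 fall into exactly #|V| ^ m classes. *)
Definition arm (y : seq V) : m.-tuple V := pad (take (size y).-1 y).

Lemma arm_rcons y v : arm (rcons y v) = pad y.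
Proof. by rewrite /arm size_rcons /= -cats1 take_size_cat. Qed.

(** The dropped last token is [eos], the very default that [pad] fills in. With [arm_rcons],
    appending any token to a complete sequence preserves its arm. *)
Lemma arm_complete y : is_complete eos y -> arm y = pad y.
Proof.
case/lastP: y => [|y v]; rewrite /is_complete // last_rcons => /andP[_ /eqP ->].
rewrite arm_rcons; apply: eq_from_tnth => i; rewrite !tnth_mktuple nth_rcons.
by case: ltngtP => // [/ltnW|->]; [exact: nth_default|rewrite nth_default].
Qed.

Lemma arm_needle (w : m.-tuple V) : arm (rcons w eos) = w.
Proof.
by rewrite arm_rcons; apply: eq_from_tnth => i; rewrite tnth_mktuple (tnth_nth eos).
Qed.

Variables (D : R) (w : m.-tuple V).

Definition needle (y : seq V) : R := D * (arm y == w)%:R.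

Lemma needle_ge0 : 0 <= D -> forall y, 0 <= needle y.
Proof. by move=> D0 y; rewrite mulr_ge0. Qed.

Lemma needle_le : 0 <= D -> forall y, needle y <= D.
Proof. by move=> D0 y; rewrite ler_piMr//; case: (_ == _). Qed.

Lemma needle_monotone : monotone_utility eos needle.
Proof.
by split=> [y|y v] cy *; rewrite /needle arm_rcons -arm_complete.
Qed.

Lemma needle_ssld L : ssld eos L 0 needle.
Proof.
move=> o a i _ io ia eq_take _.
by rewrite /needle !(take_nth eos)// !arm_rcons eq_take subrr normr0.
Qed.

Lemma needle_opt : D <= opt_value eos m.+1 needle.
Proof.
have sz : (size (rcons w eos) <= m.+1)%N by rewrite size_rcons size_tuple.
have cw : is_complete eos (rcons w eos).
  by rewrite /is_complete last_rcons eqxx andbT -size_eq0 size_rcons.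
have := @le_bigmax_cond _ _ _ 0 (Bseq sz) (fun y : m.+1.-bseq V => is_complete eos y)
  needle cw.
by rewrite /needle /= arm_needle eqxx mulr1.
Qed.

End Needle.

Section TwoPointInstance.
Variables (R : realType) (V : finType) (sigma : R).
Variables (u : seq V -> R) (q : seq V -> R) (z : seq V -> bool -> R).
Hypothesis u_ge0 : forall y, 0 <= u y.
Hypothesis q01 : forall y, 0 <= q y <= 1.
Hypothesis z_itv : forall y b, - sigma <= z y b <= sigma.
Hypothesis z_mean : forall y, q y * z y true + (1 - q y) * z y false = 0.

Definition two_point_tmab : tmab V sigma :=
  @TMAB R V sigma u (fun y => two_point (q y) (z y)) u_ge0
    (fun y => two_point_itv (q y) (z_itv y))
    (fun y => etrans (Rintegral_two_point_mean (z y) (q01 y)) (z_mean y)).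

End TwoPointInstance.

(** * Expectations over rounds as iterates of an operator *)

Section Rounds.
Variables (R : realType) (V : finType) (eos : V) (L : nat).
Variables (A : algorithm R eos L).
Hypothesis L_gt0 : (0 < L)%N.
Implicit Types (q : seq V -> R) (r : seq V -> bool -> R) (F G : history R V -> R).

(* The one-round transition operator on functions of the history, when the
   reward of y is r y true with probability q y, and r y false otherwise. *)
Definition round q r F (h : history R V) : R :=
  \sum_(y : L.-bseq V | is_complete eos y) output_prob A h y *
    (q y * F (rcons h (val y, r y true)) +
     (1 - q y) * F (rcons h (val y, r y false))).

Definition output_mean (u : seq V -> R) (h : history R V) : R :=
  \sum_(y : L.-bseq V | is_complete eos y) output_prob A h y * u y.

Lemma le_output_mean u v h : (forall y, u y <= v y) ->
  output_mean u h <= output_mean v h.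
Proof.
by move=> uv; apply: ler_sum => y _; rewrite ler_wpM2l ?output_prob_ge0.
Qed.

Lemma output_mean_cst c h : output_mean (fun=> c) h = c.
Proof. by rewrite /output_mean -mulr_suml sum_output_prob ?mul1r. Qed.

Lemma round_lin q r F G a h :
  round q r (fun h => F h + a * G h) h = round q r F h + a * round q r G h.
Proof.
by rewrite /round mulr_sumr -big_split; apply: eq_bigr => y _ /=; ring.
Qed.

Lemma iter_round_lin q r F G a k h :
  iter k (round q r) (fun h => F h + a * G h) h =
  iter k (round q r) F h + a * iter k (round q r) G h.
Proof.
elim: k h => [//|k IHk] h; rewrite !iterS -round_lin.
by congr (round _ _ _ _); apply/funext.
Qed.

Lemma iter_round_invariant q r F k h : (forall h, round q r F h = F h) ->
  iter k (round q r) F h = F h.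
Proof. by move=> /funext rF; elim: k => [//|k]; rewrite iterSr rF. Qed.

Lemma iter_round_cst q r c k h : iter k (round q r) (fun=> c) h = c.
Proof.
rewrite iter_round_invariant// => g; rewrite -[RHS](output_mean_cst c g).
by apply: eq_bigr => y _; ring.
Qed.

Lemma iter_round_sum q r (I : finType) (F : I -> history R V -> R) k h :
  iter k (round q r) (fun h => \sum_i F i h) h =
  \sum_i iter k (round q r) (F i) h.
Proof.
elim: (index_enum I) => [|i s IHs].
  rewrite big_nil -[RHS](iter_round_cst q r 0 k h).
  by congr (iter _ _ _ _); apply/funext => g; rewrite big_nil.
rewrite big_cons -IHs -[X in _ = _ + X]mul1r -iter_round_lin.
by congr (iter _ _ _ _); apply/funext => g; rewrite big_cons mul1r.
Qed.

Lemma le_round q r F G : (forall y, 0 <= q y <= 1) ->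
  (forall h, F h <= G h) -> forall h, round q r F h <= round q r G h.
Proof.
move=> q01 FG h; apply: ler_sum => y _; have /andP[q0 q1] := q01 y.
by rewrite ler_wpM2l ?output_prob_ge0// lerD// ler_wpM2l// subr_ge0.
Qed.

Lemma le_iter_round q r F G k : (forall y, 0 <= q y <= 1) ->
  (forall h, F h <= G h) ->
  forall h, iter k (round q r) F h <= iter k (round q r) G h.
Proof. by move=> q01 FG; elim: k => [//|k IHk]; exact: le_round. Qed.

Lemma expected_utility_ge0 sigma (I : tmab V sigma) k h :
  0 <= expected_utility A I k h.
Proof.
elim: k h => [|k IHk] h /=; apply: sumr_ge0 => y _; rewrite mulr_ge0 ?output_prob_ge0//.
  exact: utility_ge0.
exact: Rintegral_ge0.
Qed.

Section TwoPointRegret.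
Variables (sigma : R) (u : seq V -> R) (q : seq V -> R) (z : seq V -> bool -> R).
Hypothesis u_ge0 : forall y, 0 <= u y.
Hypothesis q01 : forall y, 0 <= q y <= 1.
Hypothesis z_itv : forall y b, - sigma <= z y b <= sigma.
Hypothesis z_mean : forall y, q y * z y true + (1 - q y) * z y false = 0.

(** The one-sided [Rintegral_two_point_le] is applied round by round; a lower bound on the regret
    calls for exactly this direction. *)
Lemma expected_utility_le k h :
  expected_utility A (two_point_tmab u_ge0 q01 z_itv z_mean) k h <=
  iter k (round q (fun y b => u y + z y b)) (output_mean u) h.
Proof.
elim: k h => [//|k IHk] h; rewrite iterS.
apply: le_trans (le_round _ q01 IHk h) => /=.
apply: ler_sum => y _; rewrite ler_wpM2l ?output_prob_ge0//=.
by apply: (Rintegral_two_point_le _ (q01 y)) => x; exact: expected_utility_ge0.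
Qed.

End TwoPointRegret.

End Rounds.

(** * Regret as needle height times expected misses *)

Section NeedleRegret.
Variables (R : realType) (V : finType) (eos : V) (m : nat) (sigma : R).
Variables (A : algorithm R eos m.+1).

Definition hit_prob (w : m.-tuple V) (h : history R V) : R :=
  output_mean A (fun y => (arm eos m y == w)%:R) h.

Lemma hit_prob_ge0 w h : 0 <= hit_prob w h.
Proof. by apply: sumr_ge0 => y _; rewrite mulr_ge0 ?output_prob_ge0. Qed.

Lemma hit_prob_le1 w h : hit_prob w h <= 1.
Proof.
rewrite -[leRHS](output_mean_cst A (ltn0Sn m) 1 h).
by apply: le_output_mean => y; case: (_ == _).
Qed.

Lemma sum_hit_prob h : \sum_w hit_prob w h = 1.
Proof.
rewrite exchange_big /= -[RHS](output_mean_cst A (ltn0Sn m) 1 h).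
apply: eq_bigr => y _; rewrite -mulr_sumr; congr (_ * _).
rewrite (bigD1 (arm eos m y))//= eqxx big1 ?addr0// => w.
by rewrite eq_sym => /negPf ->.
Qed.

Lemma output_mean_needle D w h :
  output_mean A (needle eos D w) h = D * hit_prob w h.
Proof.
by rewrite /hit_prob /output_mean /needle mulr_sumr; apply: eq_bigr => y _; ring.
Qed.

Variables (D : R) (w : m.-tuple V) (q : seq V -> R) (z : seq V -> bool -> R).
Hypothesis D_ge0 : 0 <= D.
Hypothesis q01 : forall y, 0 <= q y <= 1.
Hypothesis z_itv : forall y b, - sigma <= z y b <= sigma.
Hypothesis z_mean : forall y, q y * z y true + (1 - q y) * z y false = 0.

Lemma regret_needle_ge T :
  D * \sum_(t < T) (1 - iter t (round A q (fun y b => needle eos D w y + z y b))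
                           (hit_prob w) [::]) <=
  regret A (two_point_tmab (needle_ge0 eos w D_ge0) q01 z_itv z_mean) T.
Proof.
rewrite /regret sumrB sumr_const card_ord mulrBr lerB//.
  by rewrite mulrC ler_wpM2l// needle_opt.
rewrite mulr_sumr ler_sum// => t _.
apply: le_trans (expected_utility_le _ _ _ _ _ _ _) _.
(* Writing 0 as an iterated constant produces the shape [F + a * G] of [iter_round_lin], which pulls
   out [D]. *)
rewrite -[leRHS]add0r -[X in _ <= X + _](iter_round_cst A (ltn0Sn m) q
  (fun y b => needle eos D w y + z y b) 0 t [::]).
rewrite -iter_round_lin le_eqVlt; apply/orP; left; apply/eqP.
by congr (iter _ _ _ _); apply/funext => h; rewrite add0r output_mean_needle.
Qed.

End NeedleRegret.

Lemma exists_ge_average (R : realDomainType) (I : finType) (f : I -> R) a :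
  (0 < #|I|)%N -> #|I|%:R * a <= \sum_i f i -> exists i, a <= f i.
Proof.
move=> /card_gt0P[i _] le_sum; apply/existsP; apply: contraTT le_sum.
move=> /existsPn lt_f; rewrite -ltNge mulr_natl -sumr_const.
apply: ltr_sum; first by apply/hasP; exists i; rewrite ?mem_index_enum.
by move=> j _; rewrite ltNge.
Qed.

(** * Change of measure between fair coins and a biased arm *)

Section ChangeOfMeasure.
Variables (R : realType) (V : finType) (eos : V) (m : nat).
Variables (A : algorithm R eos m.+1) (s d : R).
Hypotheses (s_gt0 : 0 < s) (d_ge0 : 0 <= d) (d_le : d <= 4^-1).
Implicit Types (w : m.-tuple V) (h : history R V).

Definition sign_reward (y : seq V) (b : bool) : R := if b then s else - s.

(** Under this bias [sign_reward] has mean [2 * s * d] on arm [w] and 0 elsewhere, which is a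
    needle. *)
Definition needle_bias w (y : seq V) : R := 2^-1 + d * (arm eos m y == w)%:R.

Definition null_mean k := iter k (round A (fun=> 2^-1) sign_reward).
Definition needle_mean w k := iter k (round A (needle_bias w) sign_reward).

Lemma needle_bias01 w y : 0 <= needle_bias w y <= 1.
Proof. by rewrite /needle_bias; case: (_ == _) => /=; move: d_ge0 d_le; lra. Qed.

Lemma half01 (y : seq V) : 0 <= (2^-1 : R) <= 1.
Proof. lra. Qed.

Definition plays w h : R := \sum_(e <- h) (arm eos m e.1 == w)%:R.
Definition drift w h : R := \sum_(e <- h) (arm eos m e.1 == w)%:R * Num.sg e.2.
Definition likelihood w h : R :=
  \prod_(e <- h) (1 + 2 * d * ((arm eos m e.1 == w)%:R * Num.sg e.2)).

Lemma plays_ge0 w h : 0 <= plays w h.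
Proof. exact: sumr_ge0. Qed.

Lemma sum_plays h : \sum_w plays w h = (size h)%:R.
Proof.
rewrite exchange_big -sum1_size natr_sum; apply: eq_bigr => e _.
rewrite (bigD1 (arm eos m e.1))//= eqxx big1 ?addr0// => w.
by rewrite eq_sym => /negPf ->.
Qed.

Lemma null_mean_size k : null_mean k (fun h => (size h)%:R) [::] = k%:R.
Proof.
suff -> h : null_mean k (fun h => (size h)%:R) h = (size h)%:R + k%:R.
  by rewrite add0r.
elim: k h => [|k IHk] h; first by rewrite addr0.
rewrite /null_mean iterS (_ : iter k _ _ = fun h => (size h)%:R + k%:R); last first.
  exact/funext.
rewrite -[RHS](output_mean_cst A (ltn0Sn m) _ h).
apply: eq_bigr => y _; congr (_ * _).
by rewrite !size_rcons -!natr1; field.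
Qed.

(** Each round absorbs one factor of the likelihood ratio: on arm [w], (1 + 2d)/2 = 1/2 + d and (1 -
    2d)/2 = 1/2 - d. *)
Lemma needle_mean_likelihood w k F h :
  likelihood w h * iter k (round A (needle_bias w) sign_reward) F h =
  iter k (round A (fun=> 2^-1) sign_reward) (fun h => likelihood w h * F h) h.
Proof.
elim: k h => [//|k IHk] h; rewrite !iterS.
transitivity (round A (fun=> 2^-1) sign_reward (fun g => likelihood w g *
    iter k (round A (needle_bias w) sign_reward) F g) h); last first.
  by congr (round _ _ _ _ _); apply/funext.
rewrite /round mulr_sumr; apply: eq_bigr => y _.
rewrite /likelihood !big_rcons /= /needle_bias.
by rewrite (gtr0_sg s_gt0) ltr0_sg ?oppr_lt0//; field.
Qed.

(** Follows from exp(-y) >= 1 - y at y = x - 2x^2, because (1 + x)(1 - x + 2x^2) = 1 + x^2 (1 + 2x)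
    >= 1. *)
Lemma expR_le_1Dx (x : R) : - 2^-1 <= x -> expR (x - 2 * x ^+ 2) <= 1 + x.
Proof.
move=> x_ge; have x1 : 0 < 1 + x by lra.
have : 1 + (2 * x ^+ 2 - x) <= expR (- (x - 2 * x ^+ 2)).
  by rewrite opprB expR_ge1Dx.
rewrite expRN -(ler_pM2l x1) => le1.
have : 1 <= (1 + x) * (expR (x - 2 * x ^+ 2))^-1.
  apply: le_trans le1; have := mulr_ge0 (sqr_ge0 x) (_ : 0 <= 1 + 2 * x); lra.
by rewrite ler_pdivlMr ?expR_gt0// mul1r.
Qed.

(* The exponential turns the product into a sum, at the price of the quadratic
   term in 1 + x >= exp (x - 2 x^2). *)
Lemma likelihood_ge w h :
  1 + 2 * d * drift w h - 8 * d ^+ 2 * plays w h <= likelihood w h.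
Proof.
pose x (e : seq V * R) := 2 * d * ((arm eos m e.1 == w)%:R * Num.sg e.2).
(* The bound d <= 1/4 is what keeps [x e] above -1/2. The square is only bounded, since the sign of
   an arbitrary reward may be 0. *)
have x_ge e : - 2^-1 <= x e /\ x e ^+ 2 <= 4 * d ^+ 2 * (arm eos m e.1 == w)%:R.
  have := sqr_ge0 d; rewrite /x; case: (_ == _) => /=; last by nra.
  by case: sgrP => _; move: d_ge0 d_le; nra.
apply: (@le_trans _ _ (expR (\sum_(e <- h) (x e - 2 * x e ^+ 2)))).
  apply: le_trans (expR_ge1Dx _); rewrite -addrA lerD2l.
  rewrite /drift /plays !mulr_sumr -sumrN -big_split /=; apply: ler_sum => e _.
  by have [_] := x_ge e; rewrite /x; lra.
rewrite expR_sum; apply: ler_prod => e _.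
by rewrite expR_ge0 expR_le_1Dx//; case: (x_ge e).
Qed.

(** A fair coin cancels the cross term of the square, and each play of [w] adds 1 to both terms. *)
Lemma drift_martingale w k :
  null_mean k (fun h => drift w h ^+ 2 - plays w h) [::] = 0.
Proof.
rewrite /null_mean iter_round_invariant => [|h].
  by rewrite /drift /plays !big_nil expr0n subrr.
rewrite -[RHS](output_mean_cst A (ltn0Sn m) _ h).
apply: eq_bigr => y _; congr (_ * _).
rewrite /drift /plays !big_rcons /= (gtr0_sg s_gt0) ltr0_sg ?oppr_lt0//.
by case: (_ == _) => /=; field.
Qed.

Lemma miss_ge w k :
  7 / 8 - null_mean k (hit_prob A w) [::]
    - 16 * d ^+ 2 * null_mean k (plays w) [::] <=
  1 - needle_mean w k (hit_prob A w) [::].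
Proof.
have -> : 1 - needle_mean w k (hit_prob A w) [::] =
    needle_mean w k (fun h => 1 - hit_prob A w h) [::].
  rewrite -[X in X - _](iter_round_cst A (ltn0Sn m) (needle_bias w) sign_reward 1 k [::]).
  rewrite -mulN1r -iter_round_lin.
  by congr (iter _ _ _ _); apply/funext => h; rewrite mulN1r.
rewrite -[leRHS]mul1r -[X in X * needle_mean _ _ _ _](_ : likelihood w [::] = 1);
  last by rewrite /likelihood big_nil.
rewrite needle_mean_likelihood.
(* The martingale trades X^2 for N: 8 d^2 N from the likelihood bound and 8 d^2 X^2 together cost 16
   d^2 N in mean. *)
have -> : 7 / 8 - null_mean k (hit_prob A w) [::]
    - 16 * d ^+ 2 * null_mean k (plays w) [::] =
  null_mean k (fun h => 7 / 8 + (-1) * hit_prob A w h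
    + (- 8 * d ^+ 2) * (drift w h ^+ 2 - plays w h)
    + (- 16 * d ^+ 2) * plays w h) [::].
  rewrite /null_mean !iter_round_lin (iter_round_cst A (ltn0Sn m)).
  by have := drift_martingale w k; rewrite /null_mean => ->; ring.
apply: le_iter_round => [y|h]; first exact: half01.
have g0 := hit_prob_ge0 A w h; have g1 := hit_prob_le1 A w h.
have g2 : 0 <= 1 - hit_prob A w h by lra.
have := ler_wpM2r g2 (likelihood_ge w h); apply: le_trans.
(* Completing the square, 8 (dX + 1/8)^2 = 8 d^2 X^2 + 2dX + 1/8, absorbs the linear term and lowers
   1 to 7/8. *)
have := mulr_ge0 g0 (mulr_ge0 (sqr_ge0 d) (plays_ge0 w h)).
have := mulr_ge0 g0 (sqr_ge0 (d * drift w h)).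
have := mulr_ge0 g2 (sqr_ge0 (d * drift w h + 8^-1)).
move: (hit_prob A w h) (drift w h) (plays w h) g0 g1 {g2} => g X N; nra.
Qed.

Lemma exists_needle_miss T :
  (1 < #|{: m.-tuple V}|)%N -> 128 * d ^+ 2 * T%:R <= #|{: m.-tuple V}|%:R ->
  exists w, T%:R / 4 <= \sum_(t < T) (1 - needle_mean w t (hit_prob A w) [::]).
Proof.
set N := #|_| => N1 dT; apply: exists_ge_average; first exact: ltnW.
have -> : N%:R * (T%:R / 4) = \sum_(t < T) (N%:R / 4) :> R.
  by rewrite sumr_const card_ord -[RHS]mulr_natl; ring.
rewrite exchange_big /=; apply: ler_sum => t _.
have N2 : 2 <= N%:R :> R by rewrite ler_nat.
(* The sum over [w] is at least 7N/8 - 1 - 16 d^2 t >= 3N/4 - 1, hence at least N/4 as N >= 2. *)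
apply: le_trans (ler_sum _ (fun w _ => miss_ge w t)).
rewrite !sumrB sumr_const -/N -mulr_natl -mulr_sumr -!iter_round_sum//.
rewrite (_ : (fun h => \sum_w hit_prob A w h) = fun=> 1); last first.
  by apply/funext => h; exact: sum_hit_prob.
rewrite (_ : (fun h => \sum_w plays w h) = fun h => (size h)%:R); last first.
  by apply/funext => h; exact: sum_plays.
rewrite iter_round_cst// -/(null_mean t (fun h => (size h)%:R) [::]) null_mean_size.
have tT : t%:R <= T%:R :> R by rewrite ler_nat ltnW.
have := ler_wpM2l (sqr_ge0 d) tT; lra.
Qed.

End ChangeOfMeasure.

(** * The rate and the two lower bounds *)

Lemma rate_le_horizon (R : realType) n L T : rate R n L T <= T%:R.
Proof. by rewrite /rate ge_min lexx orbT. Qed.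

Lemma rate_ge0 (R : realType) n L T : 0 <= rate R n L T.
Proof. by rewrite /rate le_min sqrtr_ge0 ler0n. Qed.

Lemma sqr_rate_le (R : realType) n L T : rate R n L T ^+ 2 <= (n ^ L * T)%:R.
Proof.
rewrite -[leRHS]sqr_sqrtr ?ler0n// ler_sqr ?nnegrE ?sqrtr_ge0 ?rate_ge0//.
by rewrite /rate ge_min lexx.
Qed.

Lemma unbounded_lower_bound (R : realType) (sigma : R) (V : finType) (eos : V)
    (m T : nat) (A : algorithm R eos m.+1) :
  0 < sigma -> (1 < #|V|)%N -> (0 < m)%N -> (0 < T)%N ->
  exists I : tmab V sigma,
    [/\ monotone_utility eos (utility I), ssld eos m.+1 0 (utility I) &
        rate R #|V| m.+1 T <= regret A I T].
Proof.
move=> sigma_gt0 V_gt1 m_gt0; case: T => [//|T] _.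
have N2 : (1 < #|{: m.-tuple V}|)%N.
  by rewrite card_tuple (leq_trans V_gt1)// -{1}(expn1 #|V|) leq_exp2l.
have [w w_miss] : exists w : m.-tuple V, 2^-1 <= 1 - hit_prob A w [::].
  apply: exists_ge_average; first exact: ltnW.
  rewrite sumrB sum_hit_prob sumr_const -(ler_nat R) in N2 *.
  by rewrite -[X in _ <= X - _]mulr_natl; lra.
(* With this height, a first-round miss of probability 1/2 already costs the whole horizon. *)
have D0 : 0 <= 2 * T.+1%:R :> R by rewrite mulr_ge0.
have z_itv (y : seq V) (b : bool) : - sigma <= 0 <= sigma by lra.
have z_mean (y : seq V) : 2^-1 * 0 + (1 - 2^-1) * 0 = 0 :> R by rewrite !mulr0 addr0.
exists (two_point_tmab (needle_ge0 eos w D0) (@half01 R V) z_itv z_mean).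
split; [exact: needle_monotone|exact: needle_ssld|].
apply: le_trans (rate_le_horizon _ _ _ _) _.
apply: le_trans (regret_needle_ge _ _ _ _ _ _ _).
have hit_le1 t : iter t (round A (fun=> 2^-1)
    (fun y _ => needle eos (2 * T.+1%:R) w y + 0)) (hit_prob A w) [::] <= 1.
  rewrite -[leRHS](iter_round_cst A (ltn0Sn m) (fun=> 2^-1)
    (fun y _ => needle eos (2 * T.+1%:R) w y + 0) 1 t [::]).
  by apply: le_iter_round => [y|h]; [exact: (half01 R y)|exact: hit_prob_le1].
rewrite big_ord_recl; set S := \sum_(i < T) _.
have S0 : 0 <= S by apply: sumr_ge0 => t _; rewrite subr_ge0; exact: hit_le1.
apply: (@le_trans _ _ (2 * T.+1%:R * 2^-1)).
  by rewrite mulrAC divff ?mul1r ?pnatr_eq0.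
by rewrite ler_wpM2l// -[leLHS]addr0 lerD.
Qed.

Lemma bounded_lower_bound (R : realType) (sigma : R) (V : finType) (eos : V)
    (m T : nat) (A : algorithm R eos m.+1) (s : R) :
  0 < s -> 2 * s <= sigma -> 2 * s <= 1 -> (1 < #|V|)%N -> (0 < m)%N -> (0 < T)%N ->
  exists I : tmab V sigma,
    [/\ forall y, utility I y <= 1,
        monotone_utility eos (utility I), ssld eos m.+1 0 (utility I) &
        s / (16 * #|V|%:R) * rate R #|V| m.+1 T <= regret A I T].
Proof.
move=> s_gt0 s_sigma s1 V_gt1 m_gt0 T_gt0.
have N2 : (1 < #|{: m.-tuple V}|)%N.
  by rewrite card_tuple (leq_trans V_gt1)// -{1}(expn1 #|V|) leq_exp2l.
have n2 : 2 <= #|V|%:R :> R by rewrite ler_nat.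
have T0 : 0 < T%:R :> R by rewrite ltr0n.
set n : R := #|V|%:R in n2 *.
(* Since rate^2 <= n^(m+1) T, this gives 128 d^2 T <= 2 n^m / n <= n^m; since rate <= T, also d <=
   1/(8n). *)
pose d := rate R #|V| m.+1 T / (8 * n * T%:R).
have n8T : 0 < 8 * n * T%:R by rewrite !mulr_gt0//; lra.
have d0 : 0 <= d by rewrite divr_ge0 ?rate_ge0 ?ltW.
have d4 : d <= 4^-1.
  rewrite ler_pdivrMr//; apply: le_trans (rate_le_horizon _ _ _ _) _.
  by have := ler_wpM2r (ltW T0) n2; lra.
have dN : 128 * d ^+ 2 * T%:R <= #|{: m.-tuple V}|%:R.
  have := sqr_rate_le R #|V| m.+1 T.
  rewrite card_tuple expnS !natrM -/n.
  have -> : rate R #|V| m.+1 T = d * (8 * n * T%:R) by rewrite /d divfK ?gt_eqF.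
  set N := (#|V| ^ m)%:R => le1.
  have nT : 0 < n * T%:R by rewrite mulr_gt0//; lra.
  rewrite -(ler_pM2l nT); apply: le_trans (_ : _ <= (d * (8 * n * T%:R)) ^+ 2) _.
    have nn : 0 <= n * (n - 2) by rewrite mulr_ge0 ?subr_ge0//; lra.
    by have := mulr_ge0 (sqr_ge0 (d * T%:R)) nn; lra.
  by apply: le_trans le1 _; rewrite mulrAC.
have [w w_miss] := exists_needle_miss A s_gt0 d0 d4 N2 dN.
have D0 : 0 <= 2 * s * d by apply: mulr_ge0 d0; apply: mulr_ge0 (ltW s_gt0).
have Ds : 2 * s * d <= s / 2 by have := ler_wpM2l (ltW s_gt0) d4; lra.
(* Subtracting the mean centers the noise and leaves [s] or [-s] as the observed reward; its size is
   at most s + 2sd <= 3s/2. *)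
pose z y b := sign_reward s y b - needle eos (2 * s * d) w y.
have z_itv y b : - sigma <= z y b <= sigma.
  have := needle_ge0 eos w D0 y; have := needle_le eos w D0 y.
  by rewrite /z /sign_reward; case: b; lra.
have z_mean y : needle_bias eos d w y * z y true +
    (1 - needle_bias eos d w y) * z y false = 0.
  by rewrite /z /needle_bias /sign_reward /needle; field.
exists (two_point_tmab (needle_ge0 eos w D0) (needle_bias01 eos d0 d4 w) z_itv z_mean).
split; [|exact: needle_monotone|exact: needle_ssld|].
  by move=> y; apply: le_trans (needle_le _ _ D0 y) _; lra.
apply: le_trans (regret_needle_ge _ _ _ _ _ _ _).
have -> : (fun y b => needle eos (2 * s * d) w y + z y b) = sign_reward s.
  by apply/funext => y; apply/funext => b; rewrite /z addrC subrK.
apply: le_trans (ler_wpM2l D0 w_miss).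
(* Equality: 2sd * T/4 = s * rate / (16n). *)
rewrite le_eqVlt; apply/orP; left; apply/eqP; rewrite /d; field.
by rewrite !gt_eqF//; lra.
Qed.

(* The first part is the bound with constants independent of n, L and T, for
   arbitrary nonnegative utilities. The second part is the bound for
   utilities with values in [0, 1]; there the constant has to depend on n, since
   there are fewer than 2 * n ^ (L - 1) complete sequences of length at most L. *)
Theorem proposition4p1 (R : realType) (sigma : R) (sigma_gt0 : 0 < sigma) :
  (exists c K : R, 0 < c /\
    forall (V : finType) (eos : V) (L T : nat),
      (1 < #|V|)%N -> (1 < L)%N -> (0 < T)%N ->
      forall A : algorithm R eos L, exists I : tmab V sigma,
        [/\ monotone_utility eos (utility I),
            ssld eos L (K / Num.sqrt T%:R) (utility I) &
            c * rate R #|V| L T <= regret A I T])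
  /\
  (forall n : nat, (1 < n)%N -> exists c K : R, 0 < c /\
    forall (V : finType) (eos : V) (L T : nat),
      #|V| = n -> (1 < L)%N -> (0 < T)%N ->
      forall A : algorithm R eos L, exists I : tmab V sigma,
        [/\ forall y, utility I y <= 1,
            monotone_utility eos (utility I),
            ssld eos L (K / Num.sqrt T%:R) (utility I) &
            c * rate R #|V| L T <= regret A I T]).
Proof.
split=> [|n n1].
  (* [K] is 0 because a needle has no single-level deviation. *)
  exists 1, 0; split=> // V eos [//|m] T V1 m0 T0 A.
  by rewrite mul0r mul1r; exact: unbounded_lower_bound.
pose s := Num.min sigma 1 / 2.
have s_gt0 : 0 < s by rewrite divr_gt0// lt_min sigma_gt0 ltr01.
have s2 : 2 * s = Num.min sigma 1 by rewrite mulrC divfK ?pnatr_eq0.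
exists (s / (16 * n%:R)), 0; split.
  by rewrite divr_gt0// mulr_gt0 ?ltr0n ?(ltnW n1).
move=> V eos [//|m] T Vn m0 T0 A; rewrite mul0r -Vn.
by apply: bounded_lower_bound; rewrite ?Vn// s2 ge_min lexx ?orbT.
Qed.
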